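(* Let $n\ge 1$, let $p,p_1,\ldots,p_n$ be positive integers, let $\mathbf{U}\in \mathrm{GL}_n(\mathbb{Z})$ be a unimodular matrix, and set $\mathbf{B}_f=\mathbf{U}\cdot\mathrm{diag}(p/p_1,p/p_2,\ldots,p/p_n)$. Consider the pair of nested lattices $\Lambda_f=\mathcal{L}(\mathbf{B}_f)$ and $\Lambda_c=\mathcal{L}(p\mathbf{U})=p\mathbb{Z}^n$, and the message space $$\mathcal{I}=\{0,1,\ldots,p_1-1\}\times\cdots\times\{0,1,\ldots,p_n-1\}.$$ Let $\mathcal{R}_{\Lambda_c}$ be a fundamental region of $\Lambda_c$ and let $\mathcal{C}(\Lambda_f,\Lambda_c)=\Lambda_f\cap\mathcal{R}_{\Lambda_c}$. Then the function $f:\mathcal{I}\to\mathcal{C}(\Lambda_f,\Lambda_c)$ given by $$f(\mathbf{z})=[\mathbf{B}_f\mathbf{z}] \bmod p$$ is bijective.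
   Context: For an invertible matrix $\mathbf{B}\in\mathbb{R}^{n\times n}$, $\mathcal{L}(\mathbf{B})=\{\mathbf{B}\mathbf{k}:\mathbf{k}\in\mathbb{Z}^n\}$ is the lattice generated by the columns of $\mathbf{B}$. A fundamental region $\mathcal{R}_{\Lambda}$ of a lattice $\Lambda\subset\mathbb{R}^n$ is a set containing exactly one point of $\Lambda$ whose translates by the points of $\Lambda$ tile $\mathbb{R}^n$, so that every $\mathbf{y}\in\mathbb{R}^n$ is congruent modulo $\Lambda$ to exactly one point of $\mathcal{R}_\Lambda$ (for example $[0,p)^n$ for $\Lambda=p\mathbb{Z}^n$). The set $\mathcal{C}(\Lambda_f,\Lambda_c)=\Lambda_f\cap\mathcal{R}_{\Lambda_c}$ is called a lattice code. Since $\Lambda_c=p\mathbb{Z}^n$, reduction modulo $p$ is the same as reduction modulo $\Lambda_c$: $[\mathbf{y}]\bmod p$ denotes the unique point of $\mathcal{R}_{\Lambda_c}$ congruent to $\mathbf{y}$ modulo $p\mathbb{Z}^n$. *)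

(* Defs.v *)
From HB Require Import structures.
From mathcomp Require Import all_boot all_order all_algebra.
From mathcomp Require Import boolp classical_sets functions reals.

Set Implicit Arguments.
Unset Strict Implicit.
Unset Printing Implicit Defensive.

Import Order.TTheory GRing.Theory Num.Theory.

Local Open Scope classical_set_scope.
Local Open Scope ring_scope.

Definition intmx (R : realType) (m n : nat) (A : 'M[int]_(m, n)) : 'M[R]_(m, n) :=
  map_mx intr A.

Definition lattice (R : realType) (n : nat) (B : 'M[R]_n) : set 'cV[R]_n :=
  [set B *m intmx R k | k in [set: 'cV[int]_n]].

Definition scaled_Zn (R : realType) (n p : nat) : set 'cV[R]_n :=
  [set p%:R *: intmx R k | k in [set: 'cV[int]_n]].

Definition translate (R : realType) (n : nat) (V : set 'cV[R]_n)
    (l : 'cV[R]_n) : set 'cV[R]_n :=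
  [set l + v | v in V].

Definition fundamental_region (R : realType) (n : nat)
    (L V : set 'cV[R]_n) : Prop :=
  [/\ exists! l, (L `&` V) l,
      \bigcup_(l in L) translate V l = [set: 'cV[R]_n]
    & trivIset L (translate V)].

Definition lattice_code (R : realType) (n : nat)
    (Lf V : set 'cV[R]_n) : set 'cV[R]_n :=
  Lf `&` V.

(* The point of [V] congruent to [y] modulo [L]; it exists and is unique when
   [L] is a lattice and [V] a fundamental region of [L], so the default value
   [0] is then irrelevant. *)
Definition lattice_mod (R : realType) (n : nat)
    (L V : set 'cV[R]_n) (y : 'cV[R]_n) : 'cV[R]_n :=
  xget 0 [set v | V v /\ L (y - v)].

Definition message_space (n : nat) (q : 'I_n -> nat) : set 'cV[int]_n :=
  [set z | forall i, 0 <= z i 0 < (q i)%:Z].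

Definition fine_basis (R : realType) (n p : nat) (q : 'I_n -> nat)
    (U : 'M[int]_n) : 'M[R]_n :=
  intmx R U *m diag_mx (\row_i (p%:R / (q i)%:R)).

(* Main.v *)
(** With Q = diag(q_1, ..., q_n) one has Bf Q = p U, so Bf k and Bf l are
    congruent modulo Lc exactly when k - l lies in Q Z^n, i.e. when
    k_i = l_i mod q_i for every i. The message space contains exactly one
    representative of each such class of integer vectors. *)

Require Import Defs.
From HB Require Import structures.
From mathcomp Require Import all_boot all_order all_algebra.
From mathcomp Require Import boolp classical_sets functions reals.

Set Implicit Arguments.
Unset Strict Implicit.
Unset Printing Implicit Defensive.

Import Order.TTheory GRing.Theory Num.Theory.

Local Open Scope classical_set_scope.
Local Open Scope ring_scope.

Section LatticeTheory.
Context {R : realType} {n : nat}.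
Implicit Types (B : 'M[R]_n) (L V : set 'cV[R]_n).

Lemma intmxM k m r (A : 'M[int]_(k, m)) (C : 'M[int]_(m, r)) :
  intmx R (A *m C) = intmx R A *m intmx R C.
Proof. exact: map_mxM. Qed.

Lemma intmxB m r (A C : 'M[int]_(m, r)) :
  intmx R (A - C) = intmx R A - intmx R C.
Proof. exact: map_mxB. Qed.

Lemma intmx_inj m r : injective (@intmx R m r).
Proof.
move=> A C /matrixP AC; apply/matrixP => i j; have := AC i j.
by rewrite !mxE => /intr_inj.
Qed.

Lemma latticeB B x y : lattice B x -> lattice B y -> lattice B (x - y).
Proof.
by move=> [k _ <-] [l _ <-]; exists (k - l) => //; rewrite intmxB mulmxBr.
Qed.

Lemma lattice_mulmx_sub B (Q : 'M[int]_n) :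
  lattice (B *m intmx R Q) `<=` lattice B.
Proof. by move=> _ [k _ <-]; exists (Q *m k); rewrite // intmxM mulmxA. Qed.

(** Both [U] and [invmx U] have integer entries, so [U] permutes the integer column vectors. *)
Lemma lattice_unimodular p (U : 'M[int]_n) : U \in unitmx ->
  lattice (p%:R *: intmx R U) = @scaled_Zn R n p.
Proof.
move=> hU; apply/seteqP; split=> _ [k _ <-].
  by exists (U *m k); rewrite // intmxM scalemxAl.
by exists (invmx U *m k); rewrite // -scalemxAl -intmxM mulKVmx.
Qed.

Lemma lattice_modP L V y : fundamental_region L V ->
  V (lattice_mod L V y) /\ L (y - lattice_mod L V y).
Proof.
move=> [_ cover _]; have : [set: 'cV[R]_n] y by [].
rewrite -cover => -[l Ll [v Vv <-]].
apply: (@xgetPex _ 0 [set w | V w /\ L (l + v - w)]).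
by exists v; rewrite /= addrK.
Qed.

(** The point [y] lies in the translates of [V] by [y - v] and by [y - w]; disjointness forces these
    two vectors to agree. *)
Lemma fundamental_region_uniq L V y v w : fundamental_region L V ->
  V v -> L (y - v) -> V w -> L (y - w) -> v = w.
Proof.
move=> [_ _ disj] Vv Lv Vw Lw; apply/oppr_inj/(addrI y)/disj => //.
by exists y; split; [exists v | exists w]; rewrite // subrK.
Qed.

Lemma lattice_mod_eq L V y v : fundamental_region L V ->
  V v -> L (y - v) -> lattice_mod L V y = v.
Proof.
move=> VL Vv Lv; have [Vm Lm] := lattice_modP y VL.
exact: fundamental_region_uniq Vm Lm Vv Lv.
Qed.

End LatticeTheory.

Section FineBasis.
Context {R : realType} {n p : nat} {q : 'I_n -> nat} {U : 'M[int]_n}.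
Hypotheses (hp : (0 < p)%N) (hq : forall i, (0 < q i)%N) (hU : U \in unitmx).

Let Q : 'M[int]_n := diag_mx (\row_i (q i)%:Z).

Lemma fine_basis_diag : fine_basis R p q U *m intmx R Q = p%:R *: intmx R U.
Proof.
rewrite /fine_basis -mulmxA -mul_mx_scalar; congr (_ *m _).
apply/matrixP => i j; rewrite mul_diag_mx !mxE.
case: eqVneq => _; rewrite ?mulr0n ?mulr1n ?mulr0 //.
by rewrite divfK // pnatr_eq0 -lt0n.
Qed.

(** Invertibility is inherited from the product with [Q], which is the invertible matrix [p U]. *)
Lemma fine_basis_unit : fine_basis R p q U \in unitmx.
Proof.
have : p%:R *: intmx R U \in unitmx.
  by rewrite unitmxZ ?unitfE ?pnatr_eq0 -?lt0n // unitmxE det_map_mx rmorph_unit.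
by rewrite -fine_basis_diag unitmx_mul => /andP[].
Qed.

Lemma coarse_congruence (k l : 'cV[int]_n) :
  lattice (p%:R *: intmx R U)
    (fine_basis R p q U *m intmx R k - fine_basis R p q U *m intmx R l) <->
  forall i, (k i 0%R = l i 0%R %[mod (q i)%:Z])%Z.
Proof.
rewrite -mulmxBr -intmxB -fine_basis_diag; split.
  move=> [m _]; rewrite -mulmxA -intmxM.
  (* Cancelling the invertible fine basis leaves a real identity between integer vectors, which
     descends to [Q m = k - l] over the integers. *)
  move=> /(can_inj (mulKmx fine_basis_unit)) /intmx_inj /matrixP E i.
  apply/eqP; rewrite eqz_mod_dvd; apply/dvdzP; exists (m i 0).
  by have := E i 0; rewrite mul_diag_mx !mxE mulrC => ->.
(* The congruences make these quotients exact, so [Q] maps the witness to [k - l]. *)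
move=> kl; exists (\col_i ((k i 0%R - l i 0%R) %/ (q i)%:Z)%Z) => //.
rewrite -mulmxA -intmxM; congr (_ *m intmx R _).
apply/matrixP => i j; rewrite mul_diag_mx !mxE (ord1 j) mulrC divzK //.
by rewrite -eqz_mod_dvd; apply/eqP.
Qed.

End FineBasis.

Theorem theorem8 (R : realType) (n : nat) (hn : (0 < n)%N)
    (p : nat) (hp : (0 < p)%N)
    (q : 'I_n -> nat) (hq : forall i, (0 < q i)%N)
    (U : 'M[int]_n) (hU : U \in unitmx) :
  let Bf := fine_basis R p q U in
  let Lf := lattice Bf in
  let Lc := lattice (p%:R *: intmx R U) in
  [/\ Lc `<=` Lf,
      Lc = @scaled_Zn R n p
    & forall V : set 'cV[R]_n, fundamental_region Lc V ->
        set_bij (message_space q) (lattice_code Lf V)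
          (fun z => lattice_mod (@scaled_Zn R n p) V (Bf *m intmx R z))].
Proof.
move=> Bf Lf Lc.
have LcLf : Lc `<=` Lf.
  rewrite /Lc -(fine_basis_diag (p := p) (U := U) hq).
  exact: lattice_mulmx_sub.
have LcE : Lc = @scaled_Zn R n p by exact: lattice_unimodular.
split=> // V VLc; rewrite -LcE; split.
- move=> z _ /=; have [Vv Lv] := lattice_modP (Bf *m intmx R z) VLc.
  (* The reduction is [Bf z] minus a vector of [Lc], hence a difference of two points of [Lf]. *)
  split=> //; rewrite -[lattice_mod _ _ _](subKr (Bf *m intmx R z)).
  by apply: latticeB; [exists z | exact: LcLf].
- move=> z w; rewrite !inE => hz hw zw.
  have [_ Lz] := lattice_modP (Bf *m intmx R z) VLc.
  have [_ Lw] := lattice_modP (Bf *m intmx R w) VLc.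
  (* The common reduction cancels, leaving [Bf z - Bf w] in [Lc]. *)
  have := latticeB Lz Lw; rewrite zw opprB subrKA.
  move=> /(coarse_congruence hp hq hU) E.
  apply/matrixP => i j; rewrite (ord1 j).
  by have := E i; rewrite !modz_small ?hz ?hw.
- move=> x [[k _ <-] Vx].
  (* Taking residues of [k] keeps the class of [x = Bf k] modulo [Lc]; since [x] is already in [V],
     it is the reduction. *)
  exists (\col_i (k i 0%R %% (q i)%:Z)%Z).
    move=> i; have q_gt0 : 0 < (q i)%:Z by rewrite ltz_nat.
    by rewrite mxE modz_ge0 ?ltz_pmod // gt_eqF.
  apply: lattice_mod_eq => //; apply/(coarse_congruence hp hq hU) => i.
  by rewrite mxE modz_mod.
Qed.
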